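(* Let $\omega$ be the symmetric sum, $\omega(x,y,z) = x(y\circ z) + y(z\circ x) + z(x\circ y)$, where $u \circ v = \tfrac12(uv+vu)$. The algebra $U(A^\omega)$ has basis $\{a^i(ba)^jb^k \mid 0\le i,k\le 2,\ j\ge 0\}$, and its structure constants with respect to this basis are as follows. For all $i,n \in \{0,1,2\}$ and all integers $j,m\ge 0$: (1) for $(k,\ell)=(0,0)$ or $(k,\ell)=(1,1)$: $\; a^i (ba)^j b^k \cdot a^\ell (ba)^m b^n = a^i (ba)^{j+k+m} b^n$; (2) $a^i(ba)^j \cdot a(ba)^m b^n = -\delta_{i,0}\,\widehat{\delta}_{n,2}\,\widehat{\delta}_{j,0}\, L^{j-1}_{m,2,n+1} + \widehat{\delta}_{i,2}\, L^m_{j,i+1,n}$; (3) $a^i(ba)^j b \cdot (ba)^m b^n = -\delta_{n,0}\,\widehat{\delta}_{i,2}\,\widehat{\delta}_{m,0}\, L^{m-1}_{j,i+1,2} + \widehat{\delta}_{n,2}\, L^j_{m,i,n+1}$; (4) $a^i(ba)^j b^2 \cdot a(ba)^m b^n = -\delta_{n,0}\,\widehat{\delta}_{i,2}\, L^m_{j,i+1,2} + \widehat{\delta}_{n,2}\, L^j_{m+1,i,n+1}$; (5) $a^i(ba)^j b \cdot a^2(ba)^m b^n = -\delta_{i,0}\,\widehat{\delta}_{n,2}\, L^j_{m,2,n+1} + \widehat{\delta}_{i,2}\, L^m_{j+1,i+1,n}$; (6) $a^i(ba)^j b^2 \cdot (ba)^m b^n = \delta_{m,0}\,\delta_{n,0}\,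 a^i(ba)^j b^2$; (7) $a^i(ba)^j \cdot a^2(ba)^m b^n = \delta_{i,0}\,\delta_{j,0}\, a^2(ba)^m b^n$; (8) \[ \begin{aligned} a^i(ba)^j b^2 \cdot a^2(ba)^m b^n ={}& \sum_{s=0}^{j+1} (-1)^{s+j}\binom{j+1}{s}\Big[ -\delta_{n,0}\,\delta_{i,0}\,\widehat{\delta}_{m,0}\, L^{m-1}_{j-s+1,2,2} + \widehat{\delta}_{n,2}\,\widehat{\delta}_{i,2}\, L^{j-s+1}_{m,i+1,n+1}\Big] \\ &+ a^i(ba)^{j+m+1}b^n - a^i(ba)^{j+m+2}b^n + \delta_{i,0}\,\delta_{m,0}\,\delta_{n,0}\, a^2(ba)^j b^2 . \end{aligned} \]
   Context: $\mathbb{F}$ is a field of characteristic $0$. $A$ is the 2-dimensional space of $2\times 2$ matrices over $\mathbb{F}$ with zero diagonal, with basis $e_1 = \begin{bmatrix} 0&1\\0&0\end{bmatrix}$, $e_2 = \begin{bmatrix} 0&0\\1&0\end{bmatrix}$; it is closed under triple products $xyz$ of matrices. For a trilinear operation $\omega(x,y,z)$ (a fixed rational linear combination of the six products of $x,y,z$ in all orders), $A^\omega$ denotes the space $A$ with the trilinear operation $\omega$ computed using matrix multiplication. Let $\mathbb{F}\langle a,b\rangle$ be the free unital associative algebra and $\phi\colon A \to \mathbb{F}\langle a,b\rangle$ the linear map with $\phi(e_1)=a$, $\phi(e_2)=b$. The universal associative envelope is $U(A^\omega) = \mathbb{F}\langle a,b\rangle / I$, where $I$ is the two-sided ideal generated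 by the elements $\omega(\phi(x),\phi(y),\phi(z)) - \phi(\omega(x,y,z))$ for $x,y,z\in\{e_1,e_2\}$. The cosets of $a,b$ in $U(A^\omega)$ are again written $a,b$. $\delta_{p,q}$ is the Kronecker delta and $\widehat{\delta}_{p,q} = 1-\delta_{p,q}$. For $j,\ell,r,m\ge 0$, \[ L^m_{j,\ell,r} = \sum_{t=0}^{j} (-1)^{j+t}\binom{j}{t}\, a^\ell (ba)^{j+m-t} b^r . \] Any term with a coefficient equal to $0$ is read as $0$, even when the accompanying symbol $L$ would have a superscript $-1$. *)

(* Defs.v *)
From HB Require Import structures.
From mathcomp Require Import all_boot all_order all_algebra.
From mathcomp Require Import finmap.
From mathcomp.multinomials Require Import monalg.
From mathcomp Require Import boolp.

Set Implicit Arguments.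
Unset Strict Implicit.
Unset Printing Implicit Defensive.

Import GRing.Theory.
Local Open Scope ring_scope.
Local Open Scope quotient_scope.

Section SymmetricSum.
Variables (F : fieldType) (R : algType F).
Implicit Types x y z : R.

Definition jordan x y : R := 2^-1 *: (x * y + y * x).

Definition symsum x y z : R :=
  x * jordan y z + y * jordan z x + z * jordan x y.

End SymmetricSum.

Section ZeroDiagonal.
Variable F : fieldType.

Definition zero_diag : {pred 'M[F]_2} := [pred M : 'M[F]_2 | [forall i, M i i == 0]].

Fact zero_diag_submod_closed : submod_closed zero_diag.
Proof.
split=> [|c M N /forallP M0 /forallP N0]; apply/forallP => i; rewrite !mxE //.
by rewrite (eqP (M0 i)) (eqP (N0 i)) mulr0 addr0.
Qed.

HB.instance Definition _ :=
  GRing.isSubmodClosed.Build F 'M[F]_2 zero_diag zero_diag_submod_closed.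

Record zdmx := ZDMx { zdmx_val : 'M[F]_2; _ : zdmx_val \in zero_diag }.

HB.instance Definition _ := [isSub for zdmx_val].
HB.instance Definition _ := [Choice of zdmx by <:].
HB.instance Definition _ := [SubChoice_isSubLmodule of zdmx by <:].

Fact zero_diag_delta (i j : 'I_2) : i != j -> delta_mx i j \in zero_diag.
Proof.
move=> ij; apply/forallP => k; rewrite mxE; case: (k =P i) => [->|_] //=.
by rewrite (negbTE ij).
Qed.

Definition e1 : zdmx := ZDMx (@zero_diag_delta 0 1 isT).
Definition e2 : zdmx := ZDMx (@zero_diag_delta 1 0 isT).

Fact zero_diag_mul3 (M N P : 'M[F]_2) :
  M \in zero_diag -> N \in zero_diag -> P \in zero_diag ->
  M * N * P \in zero_diag.
Proof.
move=> /forallP M0 /forallP N0 /forallP P0; apply/forallP => i.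
rewrite -!mulmxE mxE big1 // => j _; rewrite mxE mulr_suml big1 // => k _.
have [->|ik] := eqVneq i k; first by rewrite (eqP (M0 k)) !mul0r.
have [->|kj] := eqVneq k j; first by rewrite (eqP (N0 j)) mulr0 mul0r.
have -> : j = i; last by rewrite (eqP (P0 i)) mulr0.
by move: i j k ik kj; do 3![case; case=> [|[|//]] ?] => //= *; exact: val_inj.
Qed.

Fact zero_diag_symsum (x y z : zdmx) :
  symsum (val x) (val y) (val z) \in zero_diag.
Proof.
have H (u v w : zdmx) : val u * jordan (val v) (val w) \in zero_diag.
  rewrite /jordan -scalerAr mulrDr !mulrA; apply: rpredZ.
  by apply: rpredD; apply: zero_diag_mul3; exact: valP.
by rewrite /symsum !rpredD.
Qed.

Definition zd_symsum (x y z : zdmx) : zdmx := ZDMx (zero_diag_symsum x y z).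

End ZeroDiagonal.

Section TwoSidedIdeal.
Variable R : nzRingType.

Definition two_sided_ideal (J : R -> Prop) : Prop :=
  [/\ J 0, forall x y, J x -> J y -> J (x - y)
    & forall r x s, J x -> J (r * x * s)].

Definition ideal_gen (G : R -> Prop) (x : R) : Prop :=
  forall J, two_sided_ideal J -> (forall g, G g -> J g) -> J x.

Fact ideal_gen_ideal G : two_sided_ideal (ideal_gen G).
Proof.
split=> [J [J0]|x y Gx Gy J JI GJ|r x s Gx J JI GJ] //; have [_ JB JM] := JI.
- by apply: JB; [exact: Gx | exact: Gy].
- by apply: JM; exact: Gx.
Qed.

End TwoSidedIdeal.

Section AlgebraQuotient.
Variables (F : fieldType) (R : algType F).

(* ring_quotient only quotients commutative rings, by boolean predicates. *)
Record proper_ideal := ProperIdeal {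
  pideal_mem :> R -> Prop;
  pideal_two_sided : two_sided_ideal pideal_mem;
  pideal_proper : ~ pideal_mem 1
}.

Variable I : proper_ideal.

Definition pideal_pred : {pred R} := [pred x | `[< I x >]].

Fact pideal_zmod_closed : zmod_closed pideal_pred.
Proof.
have [I0 IB _] := pideal_two_sided I.
by split=> [|x y /asboolP Ix /asboolP Iy]; apply/asboolP; [|exact: IB].
Qed.
HB.instance Definition _ :=
  GRing.isZmodClosed.Build R pideal_pred pideal_zmod_closed.

Definition algquot : Type := Quotient.quot pideal_pred.
HB.instance Definition _ := GRing.Zmodule.on algquot.

Definition algpi (x : R) : algquot := \pi_(Quotient.quot pideal_pred) x.
Definition algrepr (u : algquot) : R := repr u.

Fact algreprK : cancel algrepr algpi.
Proof. exact: reprK. Qed.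

Fact algpiP x y : algpi x = algpi y <-> I (x - y).
Proof.
split=> [e|Ixy].
  by apply/asboolP; move/eqP: e; rewrite -Quotient.idealrBE.
by apply/eqP; rewrite -Quotient.idealrBE; apply/asboolP.
Qed.

Fact algpiD x y : algpi (x + y) = algpi x + algpi y.
Proof. by rewrite /algpi pi_addr. Qed.

Definition algquot_one : algquot := algpi 1.
Definition algquot_mul (u v : algquot) : algquot :=
  algpi (algrepr u * algrepr v).
Definition algquot_scale (c : F) (u : algquot) : algquot :=
  algpi (c *: algrepr u).

Fact algrepr_piB x : I (algrepr (algpi x) - x).
Proof. by apply/algpiP; rewrite algreprK. Qed.

Fact algquot_mulE x y : algquot_mul (algpi x) (algpi y) = algpi (x * y).
Proof.
apply/algpiP; move: (algrepr_piB x) (algrepr_piB y).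
move: (algrepr (algpi x)) (algrepr (algpi y)) => x' y' Ix Iy.
have [I0 IB IM] := pideal_two_sided I.
have -> : x' * y' - x * y = 1 * (x' - x) * y' - x * - (y' - y) * 1.
  by rewrite mul1r mulr1 mulrN opprK mulrBl mulrBr addrA subrK.
by apply: (IB); apply: IM => //; rewrite -[- _]add0r; exact: IB.
Qed.

Fact algquot_scaleE c x : algquot_scale c (algpi x) = algpi (c *: x).
Proof.
apply/algpiP; move: (algrepr_piB x); move: (algrepr (algpi x)) => x' Ix.
have [I0 IB IM] := pideal_two_sided I.
have -> : c *: x' - c *: x = (c *: 1) * (x' - x) * 1.
  by rewrite mulr1 -scalerAl mul1r scalerBr.
exact: IM.
Qed.

Fact algquot_mulA : associative algquot_mul.
Proof.
move=> u v w; rewrite -(algreprK u) -(algreprK v) -(algreprK w).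
by rewrite !algquot_mulE mulrA.
Qed.

Fact algquot_mul1 : left_id algquot_one algquot_mul.
Proof. by move=> u; rewrite -(algreprK u) algquot_mulE mul1r. Qed.

Fact algquot_1mul : right_id algquot_one algquot_mul.
Proof. by move=> u; rewrite -(algreprK u) algquot_mulE mulr1. Qed.

Fact algquot_mulDl : left_distributive algquot_mul +%R.
Proof.
move=> u v w; rewrite -(algreprK u) -(algreprK v) -(algreprK w).
by rewrite -algpiD !algquot_mulE -algpiD mulrDl.
Qed.

Fact algquot_mulDr : right_distributive algquot_mul +%R.
Proof.
move=> u v w; rewrite -(algreprK u) -(algreprK v) -(algreprK w).
by rewrite -algpiD !algquot_mulE -algpiD mulrDr.
Qed.

Fact algquot_1neq0 : algquot_one != 0.
Proof.
apply/eqP => e10; apply: (@pideal_proper I); rewrite -[1]subr0.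
by apply/algpiP; rewrite -[LHS]/algquot_one e10 /algpi pi_zeror.
Qed.

HB.instance Definition _ := GRing.Zmodule_isNzRing.Build algquot
  algquot_mulA algquot_mul1 algquot_1mul algquot_mulDl algquot_mulDr
  algquot_1neq0.

Fact algquot_scaleA c d u :
  algquot_scale c (algquot_scale d u) = algquot_scale (c * d) u.
Proof. by rewrite -(algreprK u) !algquot_scaleE scalerA. Qed.

Fact algquot_scale1 : left_id 1 algquot_scale.
Proof. by move=> u; rewrite -(algreprK u) algquot_scaleE scale1r. Qed.

Fact algquot_scaleDr : right_distributive algquot_scale +%R.
Proof.
move=> c u v; rewrite -(algreprK u) -(algreprK v).
by rewrite -algpiD !algquot_scaleE -algpiD scalerDr.
Qed.

Fact algquot_scaleDl u : {morph algquot_scale^~ u : c d / c + d}.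
Proof. by move=> c d; rewrite -(algreprK u) !algquot_scaleE -algpiD scalerDl. Qed.

HB.instance Definition _ := GRing.Zmodule_isLmodule.Build F algquot
  algquot_scaleA algquot_scale1 algquot_scaleDr algquot_scaleDl.

Fact algpiM x y : algpi (x * y) = algpi x * algpi y.
Proof. by rewrite -algquot_mulE. Qed.

Fact algpiZ c x : algpi (c *: x) = c *: algpi x.
Proof. by rewrite -algquot_scaleE. Qed.

Fact algquot_scaleAl (c : F) (u v : algquot) : c *: (u * v) = (c *: u) * v.
Proof.
rewrite -(algreprK u) -(algreprK v).
by rewrite -algpiM -algpiZ scalerAl algpiM algpiZ.
Qed.

Fact algquot_scaleAr (c : F) (u v : algquot) : c *: (u * v) = u * (c *: v).
Proof.
rewrite -(algreprK u) -(algreprK v).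
by rewrite -algpiM -algpiZ scalerAr algpiM algpiZ.
Qed.

HB.instance Definition _ :=
  GRing.Lmodule_isLalgebra.Build F algquot algquot_scaleAl.
HB.instance Definition _ :=
  GRing.Lalgebra_isAlgebra.Build F algquot algquot_scaleAr.

End AlgebraQuotient.

Section Envelope.
Variable F : fieldType.

(* An alias, because monalg attaches to {malg _[_]} an algType structure that is
   only available over commutative monoids. *)
Definition freealg : Type := {malg F[{fmonom 'I_2}]}.
HB.instance Definition _ := GRing.Lalgebra.on freealg.

Fact freealg_scalerAr (c : F) (x y : freealg) : c *: (x * y) = x * (c *: y).
Proof.
have gen (R : lalgType F) (u v : R) :
    GRing.comm c%:A u -> c *: (u * v) = u * (c *: v).
  by move=> cu; rewrite -[LHS]mulr_algl -[c *: v]mulr_algl !mulrA cu.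
apply: gen; rewrite /GRing.comm mulr_algl -mul_malgC.
have -> : c%:A = c%:MP :> {malg F[{fmonom 'I_2}]} by rewrite -mul_malgC mulr1.
rewrite [x in LHS]monalgE [x in RHS]monalgE mulr_sumr mulr_suml.
by apply: eq_bigr => k _; rewrite !malgM_def !fgmulUU mul1m mulm1 mulrC.
Qed.
HB.instance Definition _ :=
  GRing.Lalgebra_isAlgebra.Build F freealg freealg_scalerAr.

Definition fa : freealg := << fmu (0 : 'I_2) >>.
Definition fb : freealg := << fmu (1 : 'I_2) >>.

Definition phi (x : zdmx F) : freealg := val x 0 1 *: fa + val x 1 0 *: fb.

Fact phi_is_linear : linear phi.
Proof.
have lin2 (V : lmodType F) (u v : V) (c p q p' q' : F) :
    (c * p + p') *: u + (c * q + q') *: v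
      = c *: (p *: u + q *: v) + (p' *: u + q' *: v).
  by rewrite !scalerDl scalerDr !scalerA addrACA.
move=> c x y; rewrite -[RHS]lin2 /phi.
have E i j : val (c *: x + y) i j = c * val x i j + val y i j by rewrite !mxE.
by move: (val (c *: x + y)) E => M E; rewrite !E.
Qed.
HB.instance Definition _ :=
  GRing.isLinear.Build F (zdmx F) freealg *:%R phi phi_is_linear.

Lemma phi_e1 : phi (e1 F) = fa.
Proof. by rewrite /phi !mxE /= scale1r scale0r addr0. Qed.

Lemma phi_e2 : phi (e2 F) = fb.
Proof. by rewrite /phi !mxE /= scale1r scale0r add0r. Qed.

Definition env_rel (g : freealg) : Prop :=
  exists x y z : zdmx F,
    [/\ x \in [:: e1 F; e2 F], y \in [:: e1 F; e2 F], z \in [:: e1 F; e2 F]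
      & g = symsum (phi x) (phi y) (phi z) - phi (zd_symsum x y z)].

(* Every relation has zero constant term, so 1 is not in the ideal. *)
Fact env_ideal_proper : ~ ideal_gen env_rel 1.
Proof.
have gen (R : algType F) (f : {rmorphism R -> F}) (x y z w : R) :
    f x = 0 -> f y = 0 -> f z = 0 -> f w = 0 -> f (symsum x y z - w) = 0.
  move=> fx fy fz fw; rewrite raddfB /= fw /symsum !raddfD /= !rmorphM /=.
  by rewrite fx fy fz !mul0r !addr0 subrr.
have gen2 (R : algType F) (f : {rmorphism R -> F}) :
    two_sided_ideal (fun x : R => f x = 0).
  split=> [|x y fx fy|r x s fx]; rewrite ?raddf0 //.
    by rewrite raddfB /= fx fy subrr.
  by rewrite !rmorphM /= fx mulr0 mul0r.
pose f : {rmorphism freealg -> F} := @mcoeff {fmonom 'I_2} F (@mone _).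
have f_phi x : f (phi x) = 0.
  have lin (V : lmodType F) (g : {scalar V}) u v p q :
      g u = 0 -> g v = 0 -> g (p *: u + q *: v) = 0.
    by move=> gu gv; rewrite linearP linearZ /= gu gv !mulr0 addr0.
  have f_gen i : mcoeff (@mone {fmonom 'I_2}) (<< fmu i >> : {malg F[_]}) = 0.
    rewrite mcoeffU; case: eqP => // /(congr1 (@fmonom_val _)).
    by rewrite fmuE fm1.
  by apply: (lin _ (mcoeff (@mone {fmonom 'I_2}) : {scalar {malg F[_]}}));
    exact: f_gen.
move=> /(_ _ (gen2 _ f)) f1; suff : f 1 = 0.
  by rewrite rmorph1 => /eqP; rewrite oner_eq0.
apply: f1 => _ [x [y [z [_ _ _ ->]]]].
by apply: gen; exact: f_phi.
Qed.

Definition env_ideal : proper_ideal freealg :=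
  ProperIdeal (ideal_gen_ideal env_rel) env_ideal_proper.

Definition envelope : Type := algquot env_ideal.
HB.instance Definition _ := GRing.Algebra.on envelope.

Definition ua : envelope := algpi env_ideal fa.
Definition ub : envelope := algpi env_ideal fb.

Definition mon (i j k : nat) : envelope := ua ^+ i * (ub * ua) ^+ j * ub ^+ k.

Definition delta (p q : nat) : F := (p == q)%:R.
Definition hdelta (p q : nat) : F := 1 - delta p q.

(* L m j l r is L^m_{j,l,r}, for m >= 0; the superscript m - 1 is written with
   truncated subtraction, since for m = 0 its coefficient vanishes. *)
Definition L (m j l r : nat) : envelope :=
  \sum_(0 <= t < j.+1) ((-1) ^+ (j + t) * 'C(j, t)%:R) *: mon l (j + m - t) r.

End Envelope.

Arguments mon F (i j k)%_N.
Arguments delta F (p q)%_N.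
Arguments hdelta F (p q)%_N.
Arguments L F (m j l r)%_N.

(* A family; linear independence makes it injective. *)
Definition is_basis (F : fieldType) (V : lmodType F) (I : eqType) (v : I -> V) :
    Prop :=
  (forall (s : seq I) (c : I -> F), uniq s ->
     \sum_(i <- s) c i *: v i = 0 -> {in s, forall i, c i = 0}) /\
  (forall x : V, exists (s : seq I) (c : I -> F), x = \sum_(i <- s) c i *: v i).

(* Main.v *)
(* Put x = ba, y = ab and z = 1 - x - y.  The relations a^2 b + aba + b a^2 = a
   and a b^2 + bab + b^2 a = b say that x, y, z commute and that moving them
   past a or b permutes them cyclically: xa = az, za = ay, ya = ax and bx = zb,
   bz = yb, by = xb.  Together with a^3 = b^3 = 0 this gives ayz = 0, yzb = 0
   and xyz = 0, and L^m_{j,l,r} = a^l x^m (1-x)^j b^r.  Each product of two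
   monomials is then a polynomial in x, y, z between powers of a and b, and is
   put in normal form by (p + q)^j = p^j + q^j for j > 0 whenever pq is killed.
   These formulas also show that the monomials span.  For independence let U
   act on F[t]^3 by a v_k = v_{k+1} (v_3 = 0), b v_0 = 0, b v_1 = t v_0 and
   b v_2 = (1 - t) v_1:
   a^i x^j b^k kills v_l for l < k and maps v_k to a nonzero multiple, depending
   only on k, of t^j v_i. *)
From HB Require Import structures.
Require Import Defs.
From mathcomp Require Import finmap.
From mathcomp.multinomials Require Import monalg.
From mathcomp Require Import ring.
From mathcomp Require Import all_boot all_order all_algebra.

Import GRing.Theory.
Local Open Scope ring_scope.

(** * Normal forms of products *)

Section CommutingPowers.
Variable R : pzRingType.
Implicit Types p q u w : R.

Lemma mulr_exp_intertwine w p q n : w * p = q * w -> w * p ^+ n = q ^+ n * w.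
Proof.
move=> e; elim: n => [|n IH]; first by rewrite !expr0 mulr1 mul1r.
by rewrite exprSr mulrA IH -mulrA e mulrA -exprSr.
Qed.

(** In the binomial expansion every term except p^n contains a factor q, which commutation moves
    next to w. *)
Lemma mull_exprD0 w p q n : GRing.comm p q -> w * q = 0 ->
  w * (p + q) ^+ n = w * p ^+ n.
Proof.
move=> pq wq; elim: n => [//|n IH].
rewrite exprSr mulrA IH mulrDr -[w * p ^+ n * q]mulrA.
by rewrite -(commrX n (commr_sym pq)) mulrA wq mul0r addr0 -mulrA -exprSr.
Qed.

Lemma mulr_exprD0 w p q n : GRing.comm p q -> q * w = 0 ->
  (p + q) ^+ n * w = p ^+ n * w.
Proof.
move=> pq qw; elim: n => [//|n IH].
rewrite exprS -mulrA IH mulrDl [q * _]mulrA.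
rewrite (commrX n (commr_sym pq)) -[_ * q * w]mulrA qw mulr0 addr0 mulrA.
by rewrite -exprS.
Qed.

(** Every mixed term of the expansion contains pq and is killed by w. The exponent has to be
    positive: at exponent 0 the right side would be 2w. *)
Lemma mull_exprD w p q n : GRing.comm p q -> w * p * q = 0 ->
  w * (p + q) ^+ n.+1 = w * p ^+ n.+1 + w * q ^+ n.+1.
Proof.
move=> pq wpq; have wqp : w * q * p = 0 by rewrite -mulrA -pq mulrA.
rewrite exprS mulrA mulrDr mulrDl (mull_exprD0 _ _ _ _ pq wpq) addrC.
rewrite [p + q]addrC (mull_exprD0 _ _ _ _ (commr_sym pq) wqp).
by rewrite -!mulrA -!exprS addrC.
Qed.

Lemma mulr_exprD w p q n : GRing.comm p q -> p * (q * w) = 0 ->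
  (p + q) ^+ n.+1 * w = p ^+ n.+1 * w + q ^+ n.+1 * w.
Proof.
move=> pq pqw; have qpw : q * (p * w) = 0 by rewrite mulrA -pq -mulrA.
rewrite exprSr -mulrA mulrDl mulrDr (mulr_exprD0 _ _ _ _ pq qpw).
rewrite [p + q]addrC (mulr_exprD0 _ _ _ _ (commr_sym pq) pqw).
by rewrite !mulrA -!exprSr.
Qed.

End CommutingPowers.

(** * Commutation rules and vanishing products forced by the defining relations *)

Section SymmetricSumRelations.
Variables (F : fieldType) (R : algType F) (a b : R).
Hypothesis a3 : a * a * a = 0.
Hypothesis b3 : b * b * b = 0.
Hypothesis aab : a * a * b + a * b * a + b * a * a = a.
Hypothesis abb : a * b * b + b * a * b + b * b * a = b.

Variables x y z : R.
Hypothesis xE : x = b * a.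
Hypothesis yE : y = a * b.
Hypothesis zE : z = 1 - x - y.

Lemma yz1x : y + z = 1 - x.
Proof. by rewrite zE [LHS]addrC subrK. Qed.

Lemma xz1y : x + z = 1 - y.
Proof. by rewrite zE addrAC [LHS]addrC subrK. Qed.

Lemma ax : a * x = y * a. Proof. by rewrite xE yE mulrA. Qed.
Lemma xb : x * b = b * y. Proof. by rewrite xE yE mulrA. Qed.

(** In az = a - aba - a^2 b, replacing the lone a by the left side of [aab] cancels two terms and
    leaves ba^2 = xa. The same substitution, with [aab] or [abb], gives [ay], [bx] and [yb]. *)
Lemma xa : x * a = a * z.
Proof.
rewrite zE !mulrBr mulr1 -[X in X - _ - _]aab xE yE !mulrA.
by rewrite [_ + b * a * a]addrC addrA !addrK.
Qed.

Lemma ay : a * y = z * a.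
Proof.
rewrite zE !mulrBl mul1r -[X in X - _ - _]aab xE yE !mulrA.
by rewrite !addrK.
Qed.

Lemma bx : b * x = z * b.
Proof.
rewrite zE !mulrBl mul1r -[X in X - _ - _]abb xE yE !mulrA.
by rewrite [_ + b * b * a]addrC addrA !addrK.
Qed.

Lemma yb : y * b = b * z.
Proof.
rewrite zE !mulrBr mulr1 -[X in X - _ - _]abb xE yE !mulrA.
by rewrite !addrK.
Qed.

(** Two of the rules suffice: xy = b(ay) = bza = (yb)a = yx. *)
Lemma xy_comm : GRing.comm x y.
Proof. by rewrite /GRing.comm xE -mulrA ay [y * _]mulrA yb mulrA. Qed.

Lemma xz_comm : GRing.comm x z.
Proof. rewrite zE; exact: commrB (commrB (commr1 x) (commr_refl x)) xy_comm. Qed.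

Lemma yz_comm : GRing.comm y z.
Proof.
rewrite zE; exact: commrB (commrB (commr1 y) (commr_sym xy_comm)) (commr_refl y).
Qed.

Lemma aay : a * a * y = 0.
Proof. by rewrite yE !mulrA a3 mul0r. Qed.

Lemma ybb : y * (b * b) = 0.
Proof. by rewrite yE -mulrA [b * _]mulrA b3 mulr0. Qed.

(** This carries the nilpotency of a and b over to x, y, z: with yz written as a^2 b^2, each of
    [ayz], [yzb] and [xyz] exhibits a cube. *)
Lemma aabb : a * a * (b * b) = y * z.
Proof. by rewrite -!mulrA [a * (b * b)]mulrA -yE yb mulrA -yE. Qed.

Lemma ayz : a * y * z = 0.
Proof. by rewrite -mulrA -aabb !mulrA a3 !mul0r. Qed.

Lemma yzb : y * z * b = 0.
Proof. by rewrite -aabb -!mulrA [b * _]mulrA b3 !mulr0. Qed.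

Lemma xaa : x * (a * a) = 0.
Proof. by rewrite xE -mulrA [a * (a * a)]mulrA a3 mulr0. Qed.

Lemma xyz : x * y * z = 0.
Proof. by rewrite -mulrA -aabb [x * _]mulrA xaa mul0r. Qed.

Lemma bbx : b * b * x = 0.
Proof. by rewrite xE mulrA b3 mul0r. Qed.

Lemma aaz j : a * a * z ^+ j = a * a * (1 - x) ^+ j.
Proof. by rewrite -yz1x addrC (mull_exprD0 _ _ _ _ _ (commr_sym yz_comm)) ?aay. Qed.

Lemma zbb j : z ^+ j * (b * b) = (1 - x) ^+ j * (b * b).
Proof. by rewrite -yz1x addrC (mulr_exprD0 _ _ _ _ _ (commr_sym yz_comm)) ?ybb. Qed.

(** Eliminates z. Since ayz = 0, the power of 1 - x = y + z splits after a into a power of y and a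
    power of z; next to a power of y the same relation lets x be replaced by x + z = 1 - y. *)
Lemma mul_azx j m :
  a * z ^+ j.+1 * x ^+ m =
  - (a * y ^+ j.+1 * (1 - y) ^+ m) + a * (1 - x) ^+ j.+1 * x ^+ m.
Proof.
rewrite -yz1x (mull_exprD _ _ _ _ _ yz_comm ayz) mulrDl -xz1y.
rewrite (mull_exprD0 _ (a * y ^+ j.+1) _ _ _ xz_comm) ?addKr //.
by rewrite exprS -!mulrA -(commrX j (commr_sym yz_comm)) !mulrA ayz mul0r.
Qed.

Lemma mul_xzb j m :
  x ^+ m * z ^+ j.+1 * b =
  - ((1 - y) ^+ m * y ^+ j.+1 * b) + x ^+ m * (1 - x) ^+ j.+1 * b.
Proof.
rewrite -yz1x -!mulrA (mulr_exprD _ _ _ _ _ yz_comm) ?[y * (z * b)]mulrA ?yzb //.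
rewrite mulrDr -xz1y (mulr_exprD0 _ (y ^+ j.+1 * b) _ _ _ xz_comm) ?addKr //.
rewrite exprSr !mulrA (commrX j (commr_sym yz_comm)) -!mulrA [z * _]mulrA.
by rewrite -yz_comm yzb mulr0.
Qed.

Lemma xy_expr M : x ^+ M.+1 * y = (1 - y) ^+ M.+1 * y - y * z ^+ M.+1.
Proof.
have xyz0 : x * (z * y) = 0 by rewrite -yz_comm mulrA xyz.
rewrite -xz1y (mulr_exprD _ _ _ _ _ xz_comm xyz0).
by rewrite (commrX M.+1 yz_comm) addrK.
Qed.

Lemma y_comm1y : GRing.comm y (1 - y).
Proof. exact: commrB (commr1 y) (commr_refl y). Qed.

Lemma axy_expr M : a * (x ^+ M * y) = a * ((1 - y) ^+ M * y).
Proof.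
rewrite -(commrX M (commr_sym xy_comm)) -(commrX M y_comm1y) -xz1y !mulrA.
by rewrite (mull_exprD0 _ _ _ _ _ xz_comm ayz).
Qed.

Lemma xyb_expr M : x ^+ M * y * b = (1 - y) ^+ M * y * b.
Proof.
rewrite -xz1y -!mulrA (mulr_exprD0 _ _ _ _ _ xz_comm) //.
by rewrite mulrA -yz_comm yzb.
Qed.

Lemma x_comm1x : GRing.comm x (1 - x).
Proof. exact: commrB (commr1 x) (commr_refl x). Qed.

Lemma expx_comm j m : x ^+ j * (1 - x) ^+ m = (1 - x) ^+ m * x ^+ j.
Proof. exact: commrX (commr_sym (commrX j (commr_sym x_comm1x))). Qed.

Lemma a1x j : a * (1 - x) ^+ j = (1 - y) ^+ j * a.
Proof.
by apply: mulr_exp_intertwine; rewrite mulrBr mulrBl mulr1 mul1r ax.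
Qed.

Lemma b1y j : b * (1 - y) ^+ j = (1 - x) ^+ j * b.
Proof.
by apply: mulr_exp_intertwine; rewrite mulrBr mulrBl mulr1 mul1r xb.
Qed.

Lemma expx_a j : x ^+ j * a = a * z ^+ j.
Proof. by rewrite (mulr_exp_intertwine _ _ _ _ _ (esym xa)). Qed.

Lemma b_expx j : b * x ^+ j = z ^+ j * b.
Proof. by rewrite (mulr_exp_intertwine _ _ _ _ _ bx). Qed.

Lemma b_expy j : b * y ^+ j = x ^+ j * b.
Proof. by rewrite (mulr_exp_intertwine _ _ _ _ _ (esym xb)). Qed.

Lemma a_expx j : a * x ^+ j = y ^+ j * a.
Proof. by rewrite (mulr_exp_intertwine _ _ _ _ _ ax). Qed.

(** Moving a to the left turns x into z, which [mul_azx] removes. The remaining y^(j+1) is ab y^j,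
    and passing b to the right turns the polynomial in y back into one in x, which explains the
    outer a^2 and b and the drop of the exponent to j. *)
Lemma expx_a_expx j m :
  x ^+ j.+1 * (a * x ^+ m) =
  - (a * a * (x ^+ j * (1 - x) ^+ m) * b) + a * (x ^+ m * (1 - x) ^+ j.+1).
Proof.
rewrite mulrA expx_a mul_azx -!mulrA -expx_comm; congr (- _ + _).
by rewrite exprS {1}yE -!mulrA -b1y [b * (y ^+ j * _)]mulrA b_expy -mulrA.
Qed.

Lemma a_expx_a_expx j m :
  a * x ^+ j * (a * x ^+ m) = a * a * (x ^+ m * (1 - x) ^+ j).
Proof.
by rewrite -mulrA [x ^+ j * _]mulrA expx_a !mulrA aaz -!mulrA expx_comm.
Qed.

Lemma expx_b_expx j m :
  x ^+ j * (b * x ^+ m.+1) =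
  - (a * (x ^+ m * (1 - x) ^+ j) * (b * b)) + x ^+ j * (1 - x) ^+ m.+1 * b.
Proof.
rewrite b_expx mulrA mul_xzb; congr (- _ + _).
rewrite expx_comm [a * _]mulrA a1x -[_ * a * _]mulrA a_expx.
by rewrite exprSr {3}yE -!mulrA.
Qed.

Lemma expx_b_expx_b j m :
  x ^+ j * (b * x ^+ m) * b = x ^+ j * (1 - x) ^+ m * (b * b).
Proof. by rewrite b_expx -!mulrA zbb. Qed.

(** The core of formula (8): expanding z = 1 - x - y yields its two isolated monomials and one term
    containing y, which still has to be normalized. *)
Lemma bbaa : b * b * (a * a) = x * z.
Proof. by rewrite -mulrA [b * (a * a)]mulrA -xE xa mulrA -xE. Qed.

Lemma expx_bbaa_expx j m :
  x ^+ j * (b * b * (a * a)) * x ^+ m =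
  x ^+ (j + m + 1) - x ^+ (j + m + 2) - x ^+ (j + m + 1) * y.
Proof.
rewrite bbaa -!mulrA (commrX m (commr_sym xz_comm)).
rewrite [x * _]mulrA -exprS mulrA -exprD addn1 addn2 addnS.
by rewrite zE !mulrBr mulr1 -exprSr.
Qed.

(** In [xy_expr], writing y as ab turns the first term into a(1-x)^(M+1) b, while y z^(M+1) = a^2
    b^2 z^M becomes a^2 x^M b^2 because b^2 z = x b^2. With an additional a on the left or b on the
    right this correction contains a cube, hence the simpler [a_expx_y] and [expx_y_b]. *)
Lemma expx_y M :
  x ^+ M.+1 * y = a * (1 - x) ^+ M.+1 * b - a * a * x ^+ M * (b * b).
Proof.
rewrite xy_expr a1x {2}yE -[_ * a * b]mulrA; congr (_ - _).
have bbz : b * b * z = x * (b * b) by rewrite -mulrA -yb mulrA -xb mulrA.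
rewrite exprS mulrA -aabb -!mulrA [b * (b * _)]mulrA.
by rewrite (mulr_exp_intertwine _ _ _ _ _ bbz).
Qed.

Lemma a_expx_y M : a * (x ^+ M * y) = a * (a * (1 - x) ^+ M * b).
Proof. by rewrite axy_expr {2}yE a1x !mulrA. Qed.

Lemma expx_y_b M : x ^+ M * y * b = a * (1 - x) ^+ M * (b * b).
Proof. by rewrite xyb_expr {2}yE a1x !mulrA. Qed.

(* [word] and [Lword] specialize to [mon] and [L] at the generators of the
   envelope, by conversion. *)
Definition word i j k : R := a ^+ i * x ^+ j * b ^+ k.

Definition Lword m j l r : R :=
  \sum_(0 <= t < j.+1) ((-1) ^+ (j + t) * 'C(j, t)%:R : F) *: word l (j + m - t) r.

(** The sign (-1)^(j+t) comes from expanding (1-u)^j as (-1)^j (u-1)^j. *)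
Lemma sum_expr1B (u : R) j :
  \sum_(0 <= t < j.+1) ((-1) ^+ (j + t) * 'C(j, t)%:R : F) *: u ^+ (j - t) =
  (1 - u) ^+ j.
Proof.
rewrite -opprB exprNn (exprBn_comm _ (commr1 u)) mulr_sumr big_mkord.
apply: eq_bigr => t _; rewrite expr1n mulr1 mulr_natr -scalerMnl mulrnAr.
rewrite mulrA -exprD; congr (_ *+ _).
by rewrite -[in LHS]signr_odd scaler_sign -[in RHS]signr_odd mulr_sign.
Qed.

Lemma LwordE m j l r : Lword m j l r = a ^+ l * (x ^+ m * (1 - x) ^+ j) * b ^+ r.
Proof.
rewrite -sum_expr1B !mulr_sumr mulr_suml; apply: eq_big_nat => t /andP[_ tj].
by rewrite /word [(j + m)%N]addnC -addnBA // (exprD x) -!scalerAr -scalerAl.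
Qed.

(** * The eight product formulas *)

Lemma a_expr3 : a ^+ 3 = 0. Proof. by rewrite exprS expr2 mulrA. Qed.
Lemma b_expr3 : b ^+ 3 = 0. Proof. by rewrite exprS expr2 mulrA. Qed.

Lemma word_mul_balanced i j k l m n : (k, l) = (0, 0)%N \/ (k, l) = (1, 1)%N ->
  word i j k * word l m n = word i (j + k + m) n.
Proof.
rewrite /word; case=> [[-> ->]|[-> ->]].
  by rewrite addn0 !expr0 mulr1 mul1r exprD !mulrA.
by rewrite !expr1 -!mulrA [b * _]mulrA -xE !exprD expr1 !mulrA.
Qed.

Lemma delta00 : delta F 0 0 = 1. Proof. by []. Qed.
Lemma deltaS0 m : delta F m.+1 0 = 0. Proof. by []. Qed.

Lemma hdelta_succ0 m : hdelta F (m + 1) 0 = 1.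
Proof. by rewrite /hdelta /delta addn1 subr0. Qed.

Lemma hdelta_Lwordl m j i r : (i < 3)%N ->
  hdelta F i 2 *: Lword m j (i + 1) r = Lword m j (i + 1) r.
Proof.
rewrite LwordE /hdelta /delta; case: i => [|[|[|//]]] _ /=.
- by rewrite subr0 scale1r.
- by rewrite subr0 scale1r.
- by rewrite a_expr3 !mul0r scaler0.
Qed.

Lemma hdelta_Lwordr m j l n : (n < 3)%N ->
  hdelta F n 2 *: Lword m j l (n + 1) = Lword m j l (n + 1).
Proof.
rewrite LwordE /hdelta /delta; case: n => [|[|[|//]]] _ /=.
- by rewrite subr0 scale1r.
- by rewrite subr0 scale1r.
- by rewrite b_expr3 !mulr0 scaler0.
Qed.

Lemma word_mul_01 i j m n : (i < 3)%N -> (n < 3)%N ->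
  word i j 0 * word 1 m n =
    - ((delta F i 0 * hdelta F n 2 * hdelta F j 0) *: Lword (j - 1) m 2 (n + 1))
    + hdelta F i 2 *: Lword m j (i + 1) n.
Proof.
move=> i3 n3; rewrite mulrAC -scalerA !(hdelta_Lwordl, hdelta_Lwordr) //.
rewrite !LwordE /word expr1 mulr1.
have -> : a ^+ i * x ^+ j * (a * x ^+ m * b ^+ n) =
          a ^+ i * (x ^+ j * (a * x ^+ m)) * b ^+ n by rewrite !mulrA.
(* For i > 0 an a stands in front of x^j; then a^2 y = 0 removes the correction, and only the second
   symbol remains. *)
rewrite /delta /hdelta /delta; case: i i3 => [|i] _; last first.
  rewrite mul0r scale0r oppr0 add0r addn1 !exprSr.
  transitivity (a ^+ i * (a * x ^+ j * (a * x ^+ m)) * b ^+ n).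
    by rewrite !mulrA.
  by rewrite a_expx_a_expx !mulrA.
(* At j = 0 the first coefficient is zero, so the truncated index j - 1 is harmless; for j > 0 it is
   the true predecessor, as in [expx_a_expx]. *)
rewrite eqxx mulr1n !mul1r; case: j => [|j].
  by rewrite /= subrr scale0r oppr0 add0r !expr0 mul1r mulr1.
rewrite expx_a_expx mulrDl mulNr subn1 subr0 scale1r addn1 (exprS b).
by rewrite expr2 !mulrA.
Qed.

Lemma word_mul_10 i j m n : (i < 3)%N -> (n < 3)%N ->
  word i j 1 * word 0 m n =
    - ((delta F n 0 * hdelta F i 2 * hdelta F m 0) *: Lword (m - 1) j (i + 1) 2)
    + hdelta F n 2 *: Lword j m i (n + 1).
Proof.
move=> i3 n3; rewrite mulrAC -scalerA !(hdelta_Lwordl, hdelta_Lwordr) //.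
rewrite !LwordE /word expr1 mul1r.
have -> : a ^+ i * x ^+ j * b * (x ^+ m * b ^+ n) =
          a ^+ i * (x ^+ j * (b * x ^+ m) * b ^+ n) by rewrite !mulrA.
rewrite /delta /hdelta /delta; case: n n3 => [|n] _; last first.
  rewrite mul0r scale0r oppr0 add0r addn1 !exprS.
  by rewrite [_ * (b * b ^+ n)]mulrA expx_b_expx_b !mulrA.
rewrite eqxx mulr1n mul1r mulr1; case: m => [|m].
  by rewrite /= subrr scale0r oppr0 add0r !expr0 !mulr1 mulrA.
rewrite expx_b_expx mulrDr mulrN subn1 subr0 scale1r addn1 (exprSr a) expr2.
by rewrite !mulrA.
Qed.

(** As b^2 a = bx, this is formula (3) at m + 1, where the condition that the exponent be nonzero
    holds. *)
Lemma word_mul_21 i j m n : (i < 3)%N -> (n < 3)%N ->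
  word i j 2 * word 1 m n =
    - ((delta F n 0 * hdelta F i 2) *: Lword m j (i + 1) 2)
    + hdelta F n 2 *: Lword j (m + 1) i (n + 1).
Proof.
move=> i3 n3; have -> : word i j 2 * word 1 m n = word i j 1 * word 0 (m + 1) n.
  by rewrite /word !expr1 addn1 (exprS x) {4}xE expr2 mul1r !mulrA.
by rewrite word_mul_10 // addnK hdelta_succ0 mulr1.
Qed.

(** As b a^2 = xa, this is formula (2) at j + 1. *)
Lemma word_mul_12 i j m n : (i < 3)%N -> (n < 3)%N ->
  word i j 1 * word 2 m n =
    - ((delta F i 0 * hdelta F n 2) *: Lword j m 2 (n + 1))
    + hdelta F i 2 *: Lword m (j + 1) (i + 1) n.
Proof.
move=> i3 n3; have -> : word i j 1 * word 2 m n = word i (j + 1) 0 * word 1 m n.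
  by rewrite /word !expr1 addn1 (exprSr x) {4}xE expr2 mulr1 !mulrA.
by rewrite word_mul_01 // addnK hdelta_succ0 mulr1.
Qed.

(** Both b^2 x and b^3 vanish, so b^2 survives only in front of the empty word. *)
Lemma word_mul_20 i j m n :
  word i j 2 * word 0 m n = (delta F m 0 * delta F n 0) *: word i j 2.
Proof.
have bb_word : b ^+ 2 * word 0 m n = (delta F m 0 * delta F n 0) *: b ^+ 2.
  rewrite /word mul1r /delta; case: m => [|m].
    case: n => [|n]; first by rewrite !mulr1 scale1r.
    by rewrite mulr0 scale0r mul1r (exprS b n) mulrA -exprSr b_expr3 mul0r.
  by rewrite mul0r scale0r expr2 (exprS x) !mulrA bbx !mul0r.
by rewrite {1}/word -mulrA bb_word -scalerAr.
Qed.

Lemma word_mul_02 i j m n :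
  word i j 0 * word 2 m n = (delta F i 0 * delta F j 0) *: word 2 m n.
Proof.
have word_aa : word i j 0 * a ^+ 2 = (delta F i 0 * delta F j 0) *: a ^+ 2.
  rewrite /word mulr1 /delta; case: j => [|j].
    case: i => [|i]; first by rewrite !mulr1 mul1r scale1r.
    by rewrite mul0r scale0r mulr1 (exprSr a i) -mulrA -exprS a_expr3 mulr0.
  by rewrite mulr0 scale0r expr2 (exprSr x) -!mulrA xaa !mulr0.
by rewrite {2}/word -mulrA mulrA word_aa -scalerAl {1}/word -mulrA.
Qed.

(** Applied to powers of 1 - x, the alternating binomial sum gives back (1 - (1 - x))^J = x^J. *)
Lemma sum_Lword_left m l r J :
  \sum_(0 <= s < J.+1) ((-1) ^+ (J + s) * 'C(J, s)%:R : F) *: Lword m (J - s) l r =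
  word l (m + J) r.
Proof.
transitivity (a ^+ l * (x ^+ m * (\sum_(0 <= s < J.+1)
    ((-1) ^+ (J + s) * 'C(J, s)%:R : F) *: (1 - x) ^+ (J - s))) * b ^+ r).
  rewrite !mulr_sumr mulr_suml; apply: eq_bigr => s _.
  by rewrite LwordE -!scalerAr -scalerAl.
by rewrite sum_expr1B opprB addrC subrK -exprD.
Qed.

Lemma sum_Lword_sup m l r J :
  \sum_(0 <= s < J.+1) ((-1) ^+ (J + s) * 'C(J, s)%:R : F) *: Lword (J - s) m l r =
  a ^+ l * (1 - x) ^+ (J + m) * b ^+ r.
Proof.
transitivity (a ^+ l * ((\sum_(0 <= s < J.+1)
    ((-1) ^+ (J + s) * 'C(J, s)%:R : F) *: x ^+ (J - s)) * (1 - x) ^+ m) * b ^+ r).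
  rewrite mulr_suml mulr_sumr mulr_suml; apply: eq_bigr => s _.
  by rewrite LwordE -scalerAl -scalerAr -scalerAl.
by rewrite sum_expr1B exprD.
Qed.

Lemma sum_Lword i j m n : (i < 3)%N -> (n < 3)%N ->
  \sum_(0 <= s < j + 2) ((-1) ^+ (s + j) * 'C(j + 1, s)%:R : F) *:
    (- ((delta F n 0 * delta F i 0 * hdelta F m 0)
          *: Lword (m - 1) (j + 1 - s) 2 2)
     + (hdelta F n 2 * hdelta F i 2) *: Lword (j + 1 - s) m (i + 1) (n + 1)) =
  (delta F n 0 * delta F i 0 * hdelta F m 0) *: word 2 (m - 1 + j.+1) 2
  - a ^+ (i + 1) * (1 - x) ^+ (j.+1 + m) * b ^+ (n + 1).
Proof.
move=> i3 n3; rewrite -sum_Lword_left -sum_Lword_sup scaler_sumr -sumrB.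
rewrite addn2; apply: eq_bigr => s _; rewrite [(j + 1)%N]addn1.
rewrite -[(hdelta F n 2 * _) *: _]scalerA hdelta_Lwordl // hdelta_Lwordr //.
(* Formula (8) has the sign (-1)^(s+j), whereas the two sums above at J = j + 1 have (-1)^(j+1+s);
   this flips the sign of both summands. *)
rewrite [(s + j)%N]addnC addSn [(-1) ^+ _.+1]exprS !mulN1r.
by rewrite !mulNr !scaleNr opprK scalerDr !scalerN !scalerA mulrC.
Qed.

(** Normalizes the term of (8) that contains y. The three cases i = n = 0, i = 0 < n and i > 0 are
    [expx_y], [expx_y_b] and [a_expx_y]. *)
Lemma word_insert_y i j m n :
  a ^+ i * (x ^+ (j + m + 1) * y) * b ^+ n =
  a ^+ (i + 1) * (1 - x) ^+ (j.+1 + m) * b ^+ (n + 1)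
  - ((delta F n 0 * delta F i 0 * hdelta F m 0) *: word 2 (m - 1 + j.+1) 2
     + (delta F i 0 * delta F m 0 * delta F n 0) *: word 2 j 2).
Proof.
(* The two words cover m > 0 and m = 0 respectively; in both cases the middle exponent is j + m. *)
have -> : (delta F n 0 * delta F i 0 * hdelta F m 0) *: word 2 (m - 1 + j.+1) 2
    + (delta F i 0 * delta F m 0 * delta F n 0) *: word 2 j 2
    = (delta F i 0 * delta F n 0) *: word 2 (j + m) 2.
  rewrite [delta F n 0 * _]mulrC mulrAC /hdelta.
  case: m => [|m]; rewrite ?delta00 ?deltaS0.
    by rewrite subrr mulr0 mul0r scale0r add0r mulr1 addn0.
  by rewrite subr0 mulr1 mulr0 mul0r scale0r addr0 subn1 addnC addSnnS.
rewrite !addn1 addSn; case: i => [|i].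
  case: n => [|n]; rewrite ?delta00 ?deltaS0.
    rewrite expx_y mulr1 scale1r !expr0 mul1r !mulr1 !expr1.
    by rewrite /word !expr2.
  rewrite mulr0 scale0r subr0 expr0 mul1r expr1 !(exprS b) mulrA expx_y_b.
  by rewrite !mulrA.
rewrite deltaS0 mul0r scale0r subr0 !(exprSr a) -[a ^+ i * a * _]mulrA a_expx_y.
by rewrite (exprS b) !mulrA.
Qed.

Lemma word_mul_22 i j m n : (i < 3)%N -> (n < 3)%N ->
  word i j 2 * word 2 m n =
    \sum_(0 <= s < j + 2) ((-1) ^+ (s + j) * 'C(j + 1, s)%:R : F) *:
      (- ((delta F n 0 * delta F i 0 * hdelta F m 0)
            *: Lword (m - 1) (j + 1 - s) 2 2)
       + (hdelta F n 2 * hdelta F i 2) *: Lword (j + 1 - s) m (i + 1) (n + 1))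
    + word i (j + m + 1) n - word i (j + m + 2) n
    + (delta F i 0 * delta F m 0 * delta F n 0) *: word 2 j 2.
Proof.
move=> i3 n3; rewrite sum_Lword //.
transitivity (a ^+ i * (x ^+ j * (b * b * (a * a)) * x ^+ m) * b ^+ n).
  by rewrite /word !expr2 !mulrA.
rewrite expx_bbaa_expx mulrBr mulrBl word_insert_y opprB mulrBr mulrBl.
rewrite -/(word i (j + m + 1) n) -/(word i (j + m + 2) n).
set W1 := word i (_ + 1) n; set W2 := word i (_ + 2) n.
set A := _ *: word 2 (_ + _) 2; set C := _ *: word 2 j 2.
set B := _ * b ^+ (n + 1).
by rewrite [A + C - B]addrAC -[A - B + W1 - W2]addrA [A - B + (_ - _)]addrC !addrA.
Qed.

End SymmetricSumRelations.

(** * Defining relations *)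

Lemma symsum_xxx (F : fieldType) (R : algType F) (x : R) : 2%:R != 0 :> F ->
  symsum x x x = (x * x * x) *+ 3.
Proof.
move=> F2; have E : jordan x x = x * x.
  by rewrite /jordan -mulr2n -scaler_nat scalerA mulVf // scale1r.
by rewrite /symsum !E !mulrA -mulr2n -mulrSr.
Qed.

(** The product x(x ∘ y) occurs twice, which cancels the half in the Jordan product. *)
Lemma symsum_xxy (F : fieldType) (R : algType F) (x y : R) : 2%:R != 0 :> F ->
  symsum x x y = x * x * y + x * y * x + y * x * x.
Proof.
move=> F2; rewrite /symsum /jordan [y * x + x * y]addrC.
rewrite -!scalerAr -scalerDr -!mulr2n -!scaler_nat scalerA mulVf // scale1r.
by rewrite [in X in _ + X]scalerAr scalerA mulVf // scale1r mulrDr !mulrA.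
Qed.

Lemma mulrn3_eq0 (F : fieldType) (V : lmodType F) (v : V) :
  3%:R != 0 :> F -> v *+ 3 = 0 -> v = 0.
Proof.
by move=> F3 /eqP; rewrite -scaler_nat scaler_eq0 (negPf F3) => /eqP.
Qed.

Lemma algpi0 (F : fieldType) (R : algType F) (I : Defs.proper_ideal R) :
  algpi I 0 = 0.
Proof. by rewrite -(subrr 0) algpiD -scaleN1r algpiZ scaleN1r subrr. Qed.

Lemma algpi_symsum (F : fieldType) (R : algType F) (I : Defs.proper_ideal R)
    (x y z : R) :
  algpi I (symsum x y z) = symsum (algpi I x) (algpi I y) (algpi I z).
Proof. by rewrite /symsum /jordan !(algpiD, algpiM, algpiZ). Qed.

Section EnvelopeRelations.
Variables (F : fieldType) (char0 : [pchar F] =i pred0).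

Let F2 : 2%:R != 0 :> F. Proof. by rewrite (iffLR (pcharf0P F) char0). Qed.

Let F3 : 3%:R != 0 :> F. Proof. by rewrite (iffLR (pcharf0P F) char0). Qed.

Lemma zd_symsum_e111 : zd_symsum (e1 F) (e1 F) (e1 F) = 0.
Proof.
apply: val_inj; rewrite /= symsum_xxx //= -!mulmxE.
by rewrite mul_delta_mx_0 // mul0mx mul0rn.
Qed.

Lemma zd_symsum_e222 : zd_symsum (e2 F) (e2 F) (e2 F) = 0.
Proof.
apply: val_inj; rewrite /= symsum_xxx //= -!mulmxE.
by rewrite mul_delta_mx_0 // mul0mx mul0rn.
Qed.

Lemma zd_symsum_e112 : zd_symsum (e1 F) (e1 F) (e2 F) = e1 F.
Proof.
apply: val_inj; rewrite /= symsum_xxy //= -!mulmxE !mul_delta_mx.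
by rewrite !mul_delta_mx_0 // mul0mx addr0 add0r.
Qed.

Lemma zd_symsum_e221 : zd_symsum (e2 F) (e2 F) (e1 F) = e2 F.
Proof.
apply: val_inj; rewrite /= symsum_xxy //= -!mulmxE !mul_delta_mx.
by rewrite !mul_delta_mx_0 // mul0mx addr0 add0r.
Qed.

Lemma envelope_rel (x y z : zdmx F) :
    x \in [:: e1 F; e2 F] -> y \in [:: e1 F; e2 F] -> z \in [:: e1 F; e2 F] ->
  symsum (algpi (env_ideal F) (phi x)) (algpi (env_ideal F) (phi y))
    (algpi (env_ideal F) (phi z)) = algpi (env_ideal F) (phi (zd_symsum x y z)).
Proof.
move=> xE yE zE; rewrite -algpi_symsum; apply/algpiP => J JI; apply.
by exists x, y, z.
Qed.

Let e1_in : e1 F \in [:: e1 F; e2 F]. Proof. by rewrite mem_head. Qed.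
Let e2_in : e2 F \in [:: e1 F; e2 F]. Proof. by rewrite !inE eqxx orbT. Qed.

Lemma ua3 : ua F * ua F * ua F = 0.
Proof.
apply: (mulrn3_eq0 _ _ _ F3); rewrite -symsum_xxx // /ua -phi_e1.
rewrite (envelope_rel _ _ _ e1_in e1_in e1_in) zd_symsum_e111 raddf0; exact: algpi0.
Qed.

Lemma ub3 : ub F * ub F * ub F = 0.
Proof.
apply: (mulrn3_eq0 _ _ _ F3); rewrite -symsum_xxx // /ub -phi_e2.
rewrite (envelope_rel _ _ _ e2_in e2_in e2_in) zd_symsum_e222 raddf0; exact: algpi0.
Qed.

Lemma uaab : ua F * ua F * ub F + ua F * ub F * ua F + ub F * ua F * ua F = ua F.
Proof.
apply: etrans (esym (symsum_xxy _ _ (ua F) (ub F) F2)) _.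
rewrite /ua /ub -phi_e1 -phi_e2 (envelope_rel _ _ _ e1_in e1_in e2_in).
by rewrite zd_symsum_e112.
Qed.

Lemma uabb : ua F * ub F * ub F + ub F * ua F * ub F + ub F * ub F * ua F = ub F.
Proof.
rewrite [_ + ub F * ua F * ub F]addrC [LHS]addrC addrA.
apply: etrans (esym (symsum_xxy _ _ (ub F) (ua F) F2)) _.
rewrite /ua /ub -phi_e1 -phi_e2 (envelope_rel _ _ _ e2_in e2_in e1_in).
by rewrite zd_symsum_e221.
Qed.

End EnvelopeRelations.

(** * Evaluating the free algebra, and the kernel of an evaluation *)

Section FreeEvaluation.
Variables (F : fieldType) (S : nzRingType) (f : {rmorphism F -> S}).
Hypothesis f_central : forall c s, GRing.comm (f c) s.
Variable g : 'I_2 -> S.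

Definition word_eval (m : {fmonom 'I_2}) : S := \prod_(i <- fmonom_val m) g i.

Fact word_eval_mmorphism : monalg.mmorphism word_eval.
Proof.
split=> [m1 m2|]; rewrite /word_eval; first by rewrite fmM big_cat.
by rewrite fm1 big_nil.
Qed.
HB.instance Definition _ :=
  monalg.isMultiplicative.Build {fmonom 'I_2} S word_eval word_eval_mmorphism.

(** Scalars act through a central ring morphism [f], so the target can be a plain ring such as
    matrices over F[t]. *)
Definition free_eval (u : freealg F) : S := mmap f word_eval u.

Lemma free_evalB : {morph free_eval : u v / u - v}.
Proof. exact: mmapB. Qed.

Lemma free_evalM : {morph free_eval : u v / u * v}.
Proof.
have [M _] := @commr_mmap_is_multiplicative _ _ _ f word_eval
  (fun _ _ _ => f_central _ _).
exact: M.
Qed.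

Lemma free_eval1 : free_eval 1 = 1.
Proof. exact: (@mmap1 _ _ _ f word_eval). Qed.

Lemma free_evalZ c u : free_eval (c *: u) = f c * free_eval u.
Proof. exact: (@mmapZ _ _ _ f word_eval). Qed.

Lemma free_eval_fa : free_eval (fa F) = g 0.
Proof. by rewrite /free_eval mmapU /= rmorph1 mul1r /word_eval fmU big_seq1. Qed.

Lemma free_eval_fb : free_eval (fb F) = g 1.
Proof. by rewrite /free_eval mmapU /= rmorph1 mul1r /word_eval fmU big_seq1. Qed.

End FreeEvaluation.

(** Induction on the letters of a word. It reduces spanning to stability under left multiplication
    by the two generators. *)
Lemma freealg_ind (F : fieldType) (P : freealg F -> Prop) :
    P 0 -> (forall u v, P u -> P v -> P (u + v)) ->
    (forall c u, P u -> P (c *: u)) -> P 1 ->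
    (forall u, P u -> P (fa F * u)) -> (forall u, P u -> P (fb F * u)) ->
  forall u, P u.
Proof.
move=> P0 PD PZ P1 Pa Pb u; rewrite [u]monalgE.
apply: big_ind => // m _.
have -> : << u@_m *g m >> = u@_m *: (<< m >> : freealg F).
  by apply/malgP => k; rewrite mcoeffZ !mcoeffU mulr_natr.
apply: PZ; case: m => s; elim: s => [|i s IH].
  by have -> : << FMonom [::] >> = 1 :> freealg F by rewrite -fmoneE.
have -> : << FMonom (i :: s) >> = << fmu i >> * << FMonom s >> :> freealg F.
  rewrite malgM_def fgmulUU mulr1; congr (<< _ >>).
  by apply/eqP; rewrite fmP fmM fmU.
have [i0|i1] : i = 0 \/ i = 1.
  by case: i => [[|[|//]] ?]; [left | right]; exact: val_inj.
  by rewrite i0; exact: Pa.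
by rewrite i1; exact: Pb.
Qed.

Lemma jordanC (F : fieldType) (R : algType F) (x y : R) : jordan x y = jordan y x.
Proof. by rewrite /jordan addrC. Qed.

(** Together with [symsumAC] this makes the operation fully symmetric, so the eight generating
    relations reduce to four. *)
Lemma symsumCA (F : fieldType) (R : algType F) (x y z : R) :
  symsum x y z = symsum y x z.
Proof.
rewrite /symsum [x * _ + _]addrC.
by rewrite (jordanC _ _ y z) (jordanC _ _ z x) (jordanC _ _ x y).
Qed.

Lemma symsumAC (F : fieldType) (R : algType F) (x y z : R) :
  symsum x y z = symsum x z y.
Proof.
rewrite /symsum addrAC.
by rewrite (jordanC _ _ y z) (jordanC _ _ z x) (jordanC _ _ x y).
Qed.

Lemma zd_symsumCA (F : fieldType) (x y z : zdmx F) :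
  zd_symsum x y z = zd_symsum y x z.
Proof. by apply: val_inj; rewrite /= symsumCA. Qed.

Lemma zd_symsumAC (F : fieldType) (x y z : zdmx F) :
  zd_symsum x y z = zd_symsum x z y.
Proof. by apply: val_inj; rewrite /= symsumAC. Qed.

Lemma zd_symsum_rel_cases (F : fieldType) (char0 : [pchar F] =i pred0)
    (R : algType F) (p : {linear zdmx F -> R}) (x y z : zdmx F) :
    x \in [:: e1 F; e2 F] -> y \in [:: e1 F; e2 F] -> z \in [:: e1 F; e2 F] ->
  let a := p (e1 F) in let b := p (e2 F) in
  let g := symsum (p x) (p y) (p z) - p (zd_symsum x y z) in
  [\/ g = (a * a * a) *+ 3, g = (b * b * b) *+ 3,
      g = a * a * b + a * b * a + b * a * a - a
    | g = b * b * a + b * a * b + a * b * b - b].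
Proof.
have F2 : 2%:R != 0 :> F by rewrite (iffLR (pcharf0P F) char0).
pose rel (x y z : zdmx F) := symsum (p x) (p y) (p z) - p (zd_symsum x y z).
have relCA u v w : rel u v w = rel v u w by rewrite /rel symsumCA zd_symsumCA.
have relAC u v w : rel u v w = rel u w v by rewrite /rel symsumAC zd_symsumAC.
move: (zd_symsum_e111 F char0) (zd_symsum_e222 F char0).
move: (zd_symsum_e112 F char0) (zd_symsum_e221 F char0).
have two (t : zdmx F) : t \in [:: e1 F; e2 F] -> t = e1 F \/ t = e2 F.
  by rewrite !inE => /orP[] /eqP; [left | right].
move: (e1 F) (e2 F) two => u v two r112 r221 r111 r222 xE yE zE a b /=.
have s111 : rel u u u = (a * a * a) *+ 3.
  by rewrite /rel r111 raddf0 subr0 symsum_xxx.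
have s222 : rel v v v = (b * b * b) *+ 3.
  by rewrite /rel r222 raddf0 subr0 symsum_xxx.
have s112 : rel u u v = a * a * b + a * b * a + b * a * a - a.
  by rewrite /rel r112 symsum_xxy.
have s221 : rel v v u = b * b * a + b * a * b + a * b * b - b.
  by rewrite /rel r221 symsum_xxy.
rewrite -[_ - _]/(rel x y z).
case: (two x xE) => ->; case: (two y yE) => ->; case: (two z zE) => ->.
- by constructor 1.
- by constructor 3.
- by constructor 3; rewrite relAC.
- by constructor 4; rewrite relCA relAC.
- by constructor 3; rewrite relCA relAC.
- by constructor 4; rewrite relAC.
- by constructor 4.
- by constructor 2.
Qed.

Lemma env_rel_cases (F : fieldType) (char0 : [pchar F] =i pred0) (g : freealg F) :
    env_rel g ->
  let a := fa F in let b := fb F in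
  [\/ g = (a * a * a) *+ 3, g = (b * b * b) *+ 3,
      g = a * a * b + a * b * a + b * a * a - a
    | g = b * b * a + b * a * b + a * b * b - b].
Proof.
case=> [x [y [z [xE yE zE ->]]]]; rewrite -phi_e1 -phi_e2.
exact: (zd_symsum_rel_cases F char0 (freealg F) (@phi F) x y z xE yE zE).
Qed.

Section Evaluation.
Variables (R S : nzRingType) (ev : R -> S).
Hypothesis evB : {morph ev : u v / u - v}.
Hypothesis evM : {morph ev : u v / u * v}.

Lemma kernel_two_sided : two_sided_ideal (fun u => ev u = 0).
Proof.
split=> [|x y x0 y0|r x s x0]; first by rewrite -(subrr 0) evB subrr.
  by rewrite evB x0 y0 subrr.
by rewrite !evM x0 mulr0 mul0r.
Qed.

Lemma sub_morphD : {morph ev : u v / u + v}.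
Proof.
have [ev0 _ _] := kernel_two_sided => x y.
by rewrite -[y in LHS]opprK evB -[- y]sub0r evB ev0 sub0r opprK.
Qed.

Lemma kernel_symsum_relations (u v g : R) (a := ev u) (b := ev v) :
    a * a * a = 0 -> b * b * b = 0 ->
    a * a * b + a * b * a + b * a * a = a ->
    b * b * a + b * a * b + a * b * b = b ->
    [\/ g = (u * u * u) *+ 3, g = (v * v * v) *+ 3,
        g = u * u * v + u * v * u + v * u * u - u
      | g = v * v * u + v * u * v + u * v * v - v] ->
  ev g = 0.
Proof.
move=> a3 b3 aab bba; have evD := sub_morphD.
case=> ->; rewrite ?(mulrS _ 2) ?(mulrS _ 1) ?mulr1n ?evB !evD !evM.
- by rewrite a3 !addr0.
- by rewrite b3 !addr0.
- by rewrite aab subrr.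
- by rewrite bba subrr.
Qed.

End Evaluation.

(** The kernel of the evaluation is a two-sided ideal, so it contains the whole ideal once it
    contains the four relations. *)
Lemma free_eval_env_ideal (F : fieldType) (char0 : [pchar F] =i pred0)
    (S : nzRingType) (f : {rmorphism F -> S}) (g : 'I_2 -> S)
    (f_central : forall c s, GRing.comm (f c) s) (a := g 0) (b := g 1) :
    a * a * a = 0 -> b * b * b = 0 ->
    a * a * b + a * b * a + b * a * a = a ->
    b * b * a + b * a * b + a * b * b = b ->
  forall u, env_ideal F u -> free_eval F S f g u = 0.
Proof.
rewrite /a /b -(free_eval_fa F S f g) -(free_eval_fb F S f g).
move=> a3 b3 aab bba u; have evB := free_evalB F S f g.
have evM := free_evalM F S f f_central g.
move=> /(_ _ (kernel_two_sided _ _ _ evB evM)); apply=> h /(env_rel_cases F char0).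
exact: (kernel_symsum_relations _ _ _ evB evM _ _ h a3 b3 aab bba).
Qed.

(** * Linear independence *)

Section MatrixModel.
Variable F : fieldType.

(* Out of range [weight] and [col_unit] vanish, so that the formulas for the
   action of [raising] and [lowering] on [col_unit k] hold for every [k]. *)
Definition weight (k : nat) : {poly F} := nth 0 [:: 'X; 1 - 'X] k.
Definition col_unit (k : nat) : 'cV[{poly F}]_3 := \col_i (i == k :> nat)%:R.
Definition raising : 'M[{poly F}]_3 := \matrix_(i, j) (i == j.+1 :> nat)%:R.
Definition lowering : 'M[{poly F}]_3 :=
  \matrix_(i, j) (weight i *+ (j == i.+1 :> nat)).

Lemma mulmx_col_unit (M : 'M[{poly F}]_3) (k : 'I_3) : M *m col_unit k = col k M.
Proof.
apply/colP => i; rewrite !mxE (bigD1 k) //= mxE eqxx mulr1 big1 ?addr0 // => j jk.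
by rewrite mxE (negPf (jk : (j != k :> nat))) mulr0.
Qed.

Lemma col_unit_ext (M N : 'M[{poly F}]_3) :
  (forall k : nat, M *m col_unit k = N *m col_unit k) -> M = N.
Proof.
move=> MN; apply/matrixP => i j; have := MN j; rewrite !mulmx_col_unit.
by move/colP/(_ i); rewrite !mxE.
Qed.

Lemma col_unit_out k : (2 < k)%N -> col_unit k = 0.
Proof.
move=> k2; apply/colP => i; rewrite !mxE.
by rewrite (ltn_eqF (leq_trans (ltn_ord i) k2)).
Qed.

Lemma raising_col_unit k : raising *m col_unit k = col_unit k.+1.
Proof.
have [k3|k3] := ltnP k 3; last by rewrite !col_unit_out ?mulmx0 // ltnW.
by rewrite -[k]/(val (Ordinal k3)) mulmx_col_unit; apply/colP => i; rewrite !mxE.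
Qed.

Lemma lowering_col_unit0 : lowering *m col_unit 0 = 0.
Proof. by rewrite (mulmx_col_unit _ ord0); apply/colP => i; rewrite !mxE. Qed.

Lemma lowering_col_unit k :
  lowering *m col_unit k.+1 = weight k *: col_unit k.
Proof.
have [k3|k3] := ltnP k.+1 3; last first.
  by rewrite col_unit_out // mulmx0 /weight nth_default ?scale0r.
rewrite -[k.+1]/(val (Ordinal k3)) mulmx_col_unit; apply/colP => i; rewrite !mxE /=.
by rewrite eqSS eq_sym; case: eqP => [->|]; rewrite ?mulr1 ?mulr0.
Qed.

Lemma mulmxrA (M N : 'M[{poly F}]_3) (v : 'cV_3) : (M * N) *m v = M *m (N *m v).
Proof. by rewrite -mulmxE mulmxA. Qed.

Lemma raising3 : raising * raising * raising = 0.
Proof.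
apply: col_unit_ext => k.
by rewrite !mulmxrA !raising_col_unit col_unit_out // mul0mx.
Qed.

Lemma lowering3 : lowering * lowering * lowering = 0.
Proof.
apply: col_unit_ext => k; rewrite !mulmxrA mul0mx.
case: k => [|k]; first by rewrite lowering_col_unit0 !mulmx0.
rewrite lowering_col_unit -!scalemxAr.
case: k => [|k]; first by rewrite lowering_col_unit0 mulmx0 scaler0.
rewrite lowering_col_unit -!scalemxAr.
case: k => [|k]; first by rewrite lowering_col_unit0 !scaler0.
by rewrite /(weight k.+2) nth_default ?scale0r.
Qed.

(** On v_k both sides are multiples of v_(k+1). The coefficient on the left is the sum of the
    weights at k - 1, k and k + 1, which is t + (1 - t) = 1 for k = 0, 1; for larger k the vector
    v_(k+1) is zero. *)
Lemma model_aab : raising * raising * lowering + raising * lowering * raising +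
  lowering * raising * raising = raising.
Proof.
apply: col_unit_ext => k; rewrite !mulmxDl !mulmxrA.
case: k => [|k]; rewrite ?lowering_col_unit0 ?mulmx0 ?add0r.
  rewrite !(raising_col_unit, lowering_col_unit) -scalemxAr raising_col_unit.
  by rewrite -scalerDl /weight /= addrC subrK scale1r.
rewrite !(raising_col_unit, lowering_col_unit) -!scalemxAr !raising_col_unit.
rewrite -!scalerDl; case: k => [|k]; last by rewrite col_unit_out ?scaler0.
by rewrite /weight /= addr0 addrC subrK scale1r.
Qed.

Lemma model_bba : lowering * lowering * raising + lowering * raising * lowering +
  raising * lowering * lowering = lowering.
Proof.
apply: col_unit_ext => k; rewrite !mulmxDl !mulmxrA.
case: k => [|k]; rewrite ?lowering_col_unit0 ?mulmx0 ?addr0.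
  rewrite raising_col_unit lowering_col_unit -scalemxAr lowering_col_unit0.
  by rewrite scaler0.
rewrite !(raising_col_unit, lowering_col_unit) -!scalemxAr.
rewrite !(raising_col_unit, lowering_col_unit) !scalerA.
case: k => [|k].
  rewrite lowering_col_unit0 mulmx0 scaler0 addr0 -scalerDl -mulrDl /weight /=.
  by rewrite subrK mul1r.
rewrite lowering_col_unit -!scalemxAr !raising_col_unit scalerA -!scalerDl.
by congr (_ *: _); case: k => [|k]; rewrite /weight /= ?nth_nil; ring.
Qed.

Lemma raising_exp i : raising ^+ i *m col_unit 0 = col_unit i.
Proof.
by elim: i => [|i IH]; rewrite ?expr0 ?mul1mx // exprS mulmxrA IH raising_col_unit.
Qed.

Lemma lowering_exp_lt k n : (n < k)%N -> lowering ^+ k *m col_unit n = 0.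
Proof.
elim: n k => [|n IH] [|k] // nk; rewrite exprSr mulmxrA.
  by rewrite lowering_col_unit0 mulmx0.
by rewrite lowering_col_unit -scalemxAr IH ?scaler0.
Qed.

Lemma lowering_exp k :
  lowering ^+ k *m col_unit k = (\prod_(t < k) weight t) *: col_unit 0.
Proof.
elim: k => [|k IH]; first by rewrite big_ord0 scale1r mul1mx.
by rewrite exprSr mulmxrA lowering_col_unit -scalemxAr IH scalerA mulrC big_ord_recr.
Qed.

Lemma lowering_raising_exp j :
  (lowering * raising) ^+ j *m col_unit 0 = 'X^j *: col_unit 0.
Proof.
elim: j => [|j IH]; first by rewrite expr0 scale1r mul1mx.
rewrite exprSr mulmxrA mulmxrA raising_col_unit lowering_col_unit -scalemxAr IH.
by rewrite scalerA -exprS.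
Qed.

Let W i j k := raising ^+ i * (lowering * raising) ^+ j * lowering ^+ k.

Lemma model_word_lt i j k n : (n < k)%N -> W i j k *m col_unit n = 0.
Proof. by move=> nk; rewrite !mulmxrA lowering_exp_lt ?mulmx0. Qed.

Lemma model_word i j k :
  W i j k *m col_unit k = ((\prod_(t < k) weight t) * 'X^j) *: col_unit i.
Proof.
rewrite !mulmxrA lowering_exp -!scalemxAr lowering_raising_exp -!scalemxAr.
by rewrite raising_exp scalerA.
Qed.

Lemma prod_weight_neq0 k : (k < 3)%N -> \prod_(t < k) weight t != 0.
Proof.
have X1 : 1 - 'X != 0 :> {poly F}.
  by rewrite -opprB oppr_eq0 -polyC1 polyXsubC_eq0.
case: k => [|[|[|//]]] _; rewrite !(big_ord_recr, big_ord0) /= ?mul1r ?oner_eq0 //.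
  by rewrite /weight polyX_eq0.
by rewrite /weight /= mulf_neq0 ?polyX_eq0.
Qed.

(** A triangularity argument by strong induction on the exponent of b. On v_k0 the words with larger
    exponent vanish, and those with smaller exponent have zero coefficients by induction. *)
Lemma model_word_free (s : seq ('I_3 * nat * 'I_3)) (c : 'I_3 * nat * 'I_3 -> F) :
  uniq s -> \sum_(x <- s) (c x)%:P%:M * W x.1.1 x.1.2 x.2 = 0 ->
  {in s, forall x, c x = 0}.
Proof.
move=> us sum0 x0 x0s; have [n] := ubnP (x0.2 : nat).
elim: n x0 x0s => // n IH [[i0 j0] k0] x0s /ltnSE /= kn.
have IHk x : x \in s -> (x.2 < k0)%N -> c x = 0.
  by move=> xs xk; apply: IH => //; exact: leq_trans xk kn.
(* Up to the nonzero product of weights, P is coordinate i0 of the image of v_k0. The coefficient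
   sought is that of t^j0 in P. *)
pose P := \sum_(x <- s)
  (if (x.2 == k0) && (x.1.1 == i0) then c x *: 'X^(x.1.2) else 0) : {poly F}.
have P0 : P = 0.
  have := congr1 (fun M => (M *m col_unit k0) i0 0) sum0.
  rewrite mul0mx mulmx_suml summxE [RHS]mxE => S0.
  apply/eqP; have := prod_weight_neq0 _ (ltn_ord k0); set w := \prod_(_ < _) _.
  move=> w0; rewrite -(inj_eq (mulfI w0)) mulr0; apply/eqP; rewrite -[RHS]S0.
  rewrite mulr_sumr big_seq [RHS]big_seq; apply: eq_bigr => x xs.
  rewrite mulmxrA mul_scalar_mx mxE.
  have [xk|xk|xk] := ltngtP x.2 k0.
  - by rewrite IHk // mul0r ifF ?mulr0 // -val_eqE /= ltn_eqF.
  - by rewrite model_word_lt // mxE mulr0 ifF ?mulr0 // -val_eqE /= gtn_eqF.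
  rewrite -val_eqE /= xk eqxx /= model_word !mxE -/w.
  rewrite -[x.1.1 == i0]val_eqE /= eq_sym; case: eqP => _; last by rewrite !mulr0.
  by rewrite mulr1 -mul_polyC mulrCA.
have := congr1 (coefp j0) P0; rewrite /coefp coef0 coef_sum (bigD1_seq _ x0s us) /=.
rewrite !eqxx /= coefZ coefXn eqxx mulr1 big1 ?addr0 // => [[[i j] k]] ne /=.
case: ifP => [/andP[/eqP ke /eqP ie]|]; last by rewrite coef0.
rewrite coefZ coefXn; case: eqP => [je|]; last by rewrite mulr0.
by rewrite /= in ke ie; rewrite ke ie je eqxx in ne.
Qed.

End MatrixModel.

(** * The basis *)

Section Span.
Variables (F : fieldType) (V : lmodType F) (I : eqType) (v : I -> V).

Definition spanned (x : V) : Prop :=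
  exists (s : seq I) (c : I -> F), x = \sum_(i <- s) c i *: v i.

Lemma spanned0 : spanned 0.
Proof. by exists [::], (fun=> 0); rewrite big_nil. Qed.

Lemma spannedZ c x : spanned x -> spanned (c *: x).
Proof.
case=> s [d ->]; exists s, (fun i => c * d i); rewrite scaler_sumr.
by apply: eq_bigr => i _; rewrite scalerA.
Qed.

Lemma spanned_addv x c j : spanned x -> spanned (c *: v j + x).
Proof.
(* Coefficients depend only on the index, and j may occur repeatedly in s. All its occurrences are
   therefore merged into a single one at the head. *)
case=> s [d ->]; exists (j :: [seq i <- s | i != j]).
exists (fun i => if i == j then c + \sum_(k <- s | k == j) d k else d i).
rewrite big_cons eqxx scalerDl -addrA; congr (_ + _).
rewrite big_filter (bigID (pred1 j)) /= scaler_suml; congr (_ + _).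
  by apply: eq_bigr => i /eqP ->.
by apply: eq_bigr => i /negPf ->.
Qed.

Lemma spannedD x y : spanned x -> spanned y -> spanned (x + y).
Proof.
case=> s [d ->] sy; elim: s => [|i s IH]; first by rewrite big_nil add0r.
by rewrite big_cons -addrA; apply: spanned_addv.
Qed.

Lemma spannedv j : spanned (v j).
Proof.
by rewrite -[v j]scale1r -[_ *: _]addr0; apply: spanned_addv; exact: spanned0.
Qed.

Lemma spannedN x : spanned x -> spanned (- x).
Proof. by rewrite -scaleN1r; exact: spannedZ. Qed.

Lemma spanned_sum (J : Type) (r : seq J) (Q : pred J) (f : J -> V) :
  (forall i, Q i -> spanned (f i)) -> spanned (\sum_(i <- r | Q i) f i).
Proof. by move=> H; apply: big_ind => //; [exact: spanned0 | exact: spannedD]. Qed.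

Lemma spanned_linear (h : V -> V) :
  (forall c x y, h (c *: x + y) = c *: h x + h y) ->
  (forall i, spanned (h (v i))) -> forall x, spanned x -> spanned (h x).
Proof.
move=> hL hv _ [s [c ->]].
have h0 : h 0 = 0.
  by have := hL (-1) 0 0; rewrite scaler0 add0r scaleN1r addNr.
elim: s => [|i s IH]; first by rewrite big_nil h0; exact: spanned0.
by rewrite big_cons hL; apply: spannedD => //; apply: spannedZ.
Qed.

End Span.

Lemma algpiX (F : fieldType) (R : algType F) (I : Defs.proper_ideal R) u n :
  algpi I (u ^+ n) = algpi I u ^+ n.
Proof. by elim: n => // n IH; rewrite !exprS algpiM IH. Qed.

Lemma algpi_sum (F : fieldType) (R : algType F) (I : Defs.proper_ideal R)
    (J : Type) (s : seq J) (c : J -> F) (u : J -> R) :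
  algpi I (\sum_(i <- s) c i *: u i) = \sum_(i <- s) c i *: algpi I (u i).
Proof.
by elim/big_ind2: _ => [|? ? ? ? <- <-|i _]; rewrite ?algpi0 ?algpiD ?algpiZ.
Qed.

Definition free_word (F : fieldType) (i j k : nat) : freealg F :=
  fa F ^+ i * (fb F * fa F) ^+ j * fb F ^+ k.

Lemma mon_free_word (F : fieldType) i j k :
  mon F i j k = algpi (env_ideal F) (free_word F i j k).
Proof. by rewrite /free_word !(algpiM, algpiX). Qed.

Lemma free_eval_sum_word (F : fieldType) (S : nzRingType) (f : {rmorphism F -> S})
    (f_central : forall c s, GRing.comm (f c) s) (g : 'I_2 -> S) (J : Type)
    (s : seq J) (c : J -> F) (i j k : J -> nat) :
  free_eval F S f g (\sum_(x <- s) c x *: free_word F (i x) (j x) (k x)) =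
  \sum_(x <- s) f (c x) * (g 0 ^+ i x * (g 1 * g 0) ^+ j x * g 1 ^+ k x).
Proof.
have evM := free_evalM F S f f_central g; have evB := free_evalB F S f g.
have evX u n : free_eval F S f g (u ^+ n) = free_eval F S f g u ^+ n.
  by elim: n => [|n IH]; [exact: free_eval1 | rewrite !exprS evM IH].
have ev0 : free_eval F S f g 0 = 0 by rewrite -(subrr 0) evB subrr.
elim: s => [|x s IH]; first by rewrite !big_nil ev0.
by rewrite !big_cons -{}IH (sub_morphD _ _ _ evB evM) free_evalZ
  /free_word !evM !evX evM free_eval_fa free_eval_fb.
Qed.

Section EnvelopeBasis.
Variables (F : fieldType) (char0 : [pchar F] =i pred0).

Let f : {rmorphism F -> 'M[{poly F}]_3} := @scalar_mx {poly F} 3 \o polyC.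
Let g (i : 'I_2) : 'M[{poly F}]_3 := if i == 0 then raising F else lowering F.

Let f_central c s : GRing.comm (f c) s.
Proof. exact: comm_scalar_mx. Qed.

(** A vanishing combination lifts to an element of the ideal, which evaluates to zero in the matrix
    model; independence there finishes the proof. *)
Lemma mon_free (s : seq ('I_3 * nat * 'I_3)) (c : 'I_3 * nat * 'I_3 -> F) :
  uniq s -> \sum_(x <- s) c x *: mon F x.1.1 x.1.2 x.2 = 0 ->
  {in s, forall x, c x = 0}.
Proof.
move=> us; under eq_bigr do rewrite mon_free_word.
rewrite -algpi_sum -(algpi0 _ _ (env_ideal F)) => /algpiP; rewrite subr0.
move/(free_eval_env_ideal F char0 _ f g f_central (raising3 F) (lowering3 F)
  (model_aab F) (model_bba F)) => ev0; apply: (model_word_free F s c us).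
apply: etrans ev0; exact: esym (free_eval_sum_word F _ f f_central g _ s c _ _ _).
Qed.

Let a3 := ua3 F char0.
Let b3 := ub3 F char0.
Let aab := uaab F char0.
Let abb := uabb F char0.

Let v (x : 'I_3 * nat * 'I_3) : envelope F := mon F x.1.1 x.1.2 x.2.
Let spanned := spanned F (envelope F) _ v.

(** Unrestricted exponents are allowed because the symbols L may involve a^3 or b^3; such monomials
    vanish. *)
Lemma spanned_mon i j k : spanned (mon F i j k).
Proof.
have [i3|i3] := ltnP i 3; last first.
  rewrite /mon -(subnKC i3) exprD (a_expr3 _ _ _ a3) !mul0r; exact: spanned0.
have [k3|k3] := ltnP k 3; last first.
  rewrite /mon -(subnKC k3) [ub F ^+ (3 + _)]exprD (b_expr3 _ _ _ b3) mul0r mulr0.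
  exact: spanned0.
exact: (spannedv _ _ _ v (Ordinal i3, j, Ordinal k3)).
Qed.

Lemma spanned_L m j l r : spanned (L F m j l r).
Proof.
by apply: spanned_sum => t _; apply: spannedZ; exact: spanned_mon.
Qed.

Lemma spanned_ua x : spanned x -> spanned (ua F * x).
Proof.
apply: spanned_linear => [c u w|i]; first by rewrite mulrDr scalerAr.
by rewrite /v /mon !mulrA -exprS; exact: spanned_mon.
Qed.

Lemma spanned_ub x : spanned x -> spanned (ub F * x).
Proof.
apply: spanned_linear => [c u w|[[i j] k]]; first by rewrite mulrDr scalerAr.
(* As b is itself a monomial, formulas (3), (1) and (5) expand the product for i = 0, 1, 2
   respectively. *)
have -> : ub F * v (i, j, k) = mon F 0 0 1 * mon F i j k.
  by rewrite {1}/mon !expr0 !mul1r expr1.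
case: i => [[|[|[|//]]] i3]; rewrite /=.
- rewrite [_ * _](word_mul_10 _ _ _ _ a3 b3 aab abb _ _ _ erefl erefl erefl) //.
  by apply: spannedD; [apply: spannedN|]; apply: spannedZ; exact: spanned_L.
- rewrite [_ * _](word_mul_balanced _ _ _ _ _ erefl); last by right.
  exact: spanned_mon.
- rewrite [_ * _](word_mul_12 _ _ _ _ a3 b3 aab abb _ _ _ erefl erefl erefl) //.
  by apply: spannedD; [apply: spannedN|]; apply: spannedZ; exact: spanned_L.
Qed.

Lemma spanned_envelope (x : envelope F) : spanned x.
Proof.
rewrite -(algreprK x); move: (algrepr x) => u {x}.
elim/freealg_ind: u => [|u w|c u||u|u].
- by rewrite algpi0; exact: spanned0.
- by rewrite algpiD; exact: spannedD.
- by rewrite algpiZ; exact: spannedZ.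
- have -> : algpi (env_ideal F) 1 = mon F 0 0 0 by rewrite /mon !expr0 !mulr1.
  exact: spanned_mon.
- by rewrite algpiM; exact: spanned_ua.
- by rewrite algpiM; exact: spanned_ub.
Qed.

End EnvelopeBasis.


Theorem theorem4p13 (F : fieldType) (char0 : [pchar F] =i pred0) :
  is_basis (fun x : 'I_3 * nat * 'I_3 => mon F x.1.1 x.1.2 x.2) /\
  forall (i n : 'I_3) (j m : nat),
  (* (1) *)
  (forall k l : nat, (k, l) = (0, 0)%N \/ (k, l) = (1, 1)%N ->
     mon F i j k * mon F l m n = mon F i (j + k + m) n) /\
  (* (2) *)
  mon F i j 0 * mon F 1 m n =
    - ((delta F i 0 * hdelta F n 2 * hdelta F j 0) *: L F (j - 1) m 2 (n + 1))
    + hdelta F i 2 *: L F m j (i + 1) n /\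
  (* (3) *)
  mon F i j 1 * mon F 0 m n =
    - ((delta F n 0 * hdelta F i 2 * hdelta F m 0) *: L F (m - 1) j (i + 1) 2)
    + hdelta F n 2 *: L F j m i (n + 1) /\
  (* (4) *)
  mon F i j 2 * mon F 1 m n =
    - ((delta F n 0 * hdelta F i 2) *: L F m j (i + 1) 2)
    + hdelta F n 2 *: L F j (m + 1) i (n + 1) /\
  (* (5) *)
  mon F i j 1 * mon F 2 m n =
    - ((delta F i 0 * hdelta F n 2) *: L F j m 2 (n + 1))
    + hdelta F i 2 *: L F m (j + 1) (i + 1) n /\
  (* (6) *)
  mon F i j 2 * mon F 0 m n = (delta F m 0 * delta F n 0) *: mon F i j 2 /\
  (* (7) *)
  mon F i j 0 * mon F 2 m n = (delta F i 0 * delta F j 0) *: mon F 2 m n /\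
  (* (8) *)
  mon F i j 2 * mon F 2 m n =
    \sum_(0 <= s < j + 2) ((-1) ^+ (s + j) * 'C(j + 1, s)%:R) *:
      (- ((delta F n 0 * delta F i 0 * hdelta F m 0)
            *: L F (m - 1) (j + 1 - s) 2 2)
       + (hdelta F n 2 * hdelta F i 2) *: L F (j + 1 - s) m (i + 1) (n + 1))
    + mon F i (j + m + 1) n - mon F i (j + m + 2) n
    + (delta F i 0 * delta F m 0 * delta F n 0) *: mon F 2 j 2.
Proof.
split; first by split; [exact: mon_free | exact: spanned_envelope].
move=> i n j m; have [i3 n3] := (ltn_ord i, ltn_ord n).
move: (ua3 F char0) (ub3 F char0) (uaab F char0) (uabb F char0) => a3 b3 aab abb.
do 7?[split].
- by move=> k l; exact: (word_mul_balanced _ _ _ _ _ erefl).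
(* The three [erefl] fix x = ba, y = ab and z = 1 - x - y in the envelope. *)
- exact: (word_mul_01 _ _ _ _ a3 b3 aab abb _ _ _ erefl erefl erefl).
- exact: (word_mul_10 _ _ _ _ a3 b3 aab abb _ _ _ erefl erefl erefl).
- exact: (word_mul_21 _ _ _ _ a3 b3 aab abb _ _ _ erefl erefl erefl).
- exact: (word_mul_12 _ _ _ _ a3 b3 aab abb _ _ _ erefl erefl erefl).
- exact: (word_mul_20 _ _ _ _ b3 _ erefl).
- exact: (word_mul_02 _ _ _ _ a3 _ erefl).
- exact: (word_mul_22 _ _ _ _ a3 b3 aab abb _ _ _ erefl erefl erefl).
Qed.
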